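(* Let $\Omega\subset\mathbb{R}^n$ be a bounded domain, let $g:\partial\Omega\to\mathbb{R}$ be continuous, and let $\varepsilon>0$. Let $\underline{\mathcal{S}}$ and $\overline{\mathcal{S}}$ be the sets of all subsolutions and of all supersolutions, respectively, of the problem $$u(x)=\tfrac12\sup_{B_\varepsilon(x)}u+\tfrac12\inf_{B_\varepsilon(x)}u\quad\text{for }x\in\Omega,\qquad u=g\quad\text{on }\partial\Omega, \qquad (\ast)$$ and define, for $x\in\overline{\Omega}$, $$\overline{u}(x):=\sup_{u\in\underline{\mathcal{S}}}u(x),\qquad \underline{u}(x):=\inf_{u\in\overline{\mathcal{S}}}u(x).$$ Then both $\overline{u}$ and $\underline{u}$ are solutions of $(\ast)$.
   Context: Here $B_\varepsilon(x)$ is the open ball of radius $\varepsilon$ centered at $x$, and for $u:\overline{\Omega}\to\mathbb{R}$ the supremum and infimum over $B_\varepsilon(x)$ are taken over $B_\varepsilon(x)\cap\overline{\Omega}$. A function $u:\overline{\Omega}\to\mathbb{R}$ with $\sup_{\overline{\Omega}}u<\infty$ is a subsolution of $(\ast)$ if $u(x)\le\frac12\sup_{B_\varepsilon(x)}u+\frac12\inf_{B_\varepsilon(x)}u$ for all $x\in\Omega$ and $u\le g$ on $\partial\Omega$. A function $u:\overline{\Omega}\to\mathbb{R}$ with $\inf_{\overline{\Omega}}u>-\infty$ is a supersolution of $(\ast)$ if $u(x)\ge\frac12\sup_{B_\varepsilon(x)}u+\frac12\inf_{B_\varepsilon(x)}u$ for all $x\in\Omega$ and $u\ge g$ on $\partial\Omega$.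 A function $u:\overline{\Omega}\to\mathbb{R}$ is a solution of $(\ast)$ if it is simultaneously a subsolution and a supersolution. No continuity or measurability of $u$ is assumed. *)

(* Defs.v *)
From HB Require Import structures.
From mathcomp Require Import all_boot all_order all_algebra.
From mathcomp Require Import all_classical all_reals all_analysis.

Set Implicit Arguments.
Unset Strict Implicit.
Unset Printing Implicit Defensive.

Import Order.TTheory GRing.Theory Num.Theory.
Import numFieldNormedType.Exports.

Local Open Scope classical_set_scope.
Local Open Scope ring_scope.

(* The norm (and `ball`) that MathComp-Analysis puts on row vectors is the
   max norm; it yields the usual topology and bounded sets of R^n, but not the
   round balls, hence this Euclidean norm. *)
Definition enorm (R : realType) (n : nat) (x : 'rV[R]_n) : R :=
  Num.sqrt (\sum_(i < n) x ord0 i ^+ 2).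

Definition eball (R : realType) (n : nat) (x : 'rV[R]_n) (e : R) :
    set 'rV[R]_n :=
  [set y | enorm (x - y) < e].

Definition boundary (T : topologicalType) (A : set T) : set T :=
  closure A `\` interior A.

Definition bounded_domain (R : realType) (n : nat) (Omega : set 'rV[R]_n) :
    Prop :=
  [/\ Omega !=set0, open Omega, connected Omega & bounded_set Omega].

Section Problem.
Variables (R : realType) (n : nat).
Variables (Omega : set 'rV[R]_n) (g : 'rV[R]_n -> R) (eps : R).

(* A function on closure Omega (resp. on the boundary) is represented by a total
   function of which only the values on that set are ever used. Sups and infs
   are extended-real, since a subsolution may be unbounded below and a
   supersolution unbounded above; the one-sided bounds in the definitions below
   exclude the indeterminate sum +oo - oo. *)
Local Open Scope ereal_scope.

Definition sup_on (A : set 'rV[R]_n) (u : 'rV[R]_n -> R) : \bar R :=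
  ereal_sup [set (u y)%:E | y in A].

Definition inf_on (A : set 'rV[R]_n) (u : 'rV[R]_n -> R) : \bar R :=
  ereal_inf [set (u y)%:E | y in A].

Definition midrange (u : 'rV[R]_n -> R) (x : 'rV[R]_n) : \bar R :=
  (2^-1)%:E * sup_on (eball x eps `&` closure Omega) u +
  (2^-1)%:E * inf_on (eball x eps `&` closure Omega) u.

Definition subsolution (u : 'rV[R]_n -> R) : Prop :=
  [/\ sup_on (closure Omega) u < +oo,
      forall x, Omega x -> (u x)%:E <= midrange u x
    & forall x, boundary Omega x -> (u x <= g x)%R].

Definition supersolution (u : 'rV[R]_n -> R) : Prop :=
  [/\ -oo < inf_on (closure Omega) u,
      forall x, Omega x -> midrange u x <= (u x)%:E
    & forall x, boundary Omega x -> (g x <= u x)%R].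

Definition solution (u : 'rV[R]_n -> R) : Prop :=
  subsolution u /\ supersolution u.

Definition upper_envelope (x : 'rV[R]_n) : \bar R :=
  ereal_sup [set (u x)%:E | u in subsolution].

Definition lower_envelope (x : 'rV[R]_n) : \bar R :=
  ereal_inf [set (u x)%:E | u in supersolution].

(* A solution is real-valued, so an extended-real function v is a solution only
   if it is finite on closure Omega. *)
Definition esolution (v : 'rV[R]_n -> \bar R) : Prop :=
  (forall x, closure Omega x -> v x \is a fin_num) /\ solution (fine \o v).

End Problem.

(* Main.v *)
Require Import Defs.
From HB Require Import structures.
From mathcomp Require Import all_boot all_order all_algebra.
From mathcomp Require Import all_classical all_reals all_analysis.
From mathcomp Require Import lra.
Set Implicit Arguments.
Unset Strict Implicit.
Unset Printing Implicit Defensive.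
Import Order.TTheory GRing.Theory Num.Theory.
Import numFieldNormedType.Exports.
Local Open Scope classical_set_scope.
Local Open Scope ring_scope.

(** The argument is Perron's method; the point that needs care is that nothing
    is assumed on subsolutions beyond an upper bound, so finiteness of the
    envelopes has to come out of the inequality itself.

    A priori bound.  Let [u] be a subsolution with [u <= A] on the closure.  If
    [x] is interior and [y] lies in the [eps]-ball of [x], then
    [u x <= (A + u y) / 2], that is, [A - u y <= 2 * (A - u x)]
    ([subsolution_gap_ball]): one step inside a ball at most doubles the gap
    below [A].  From any interior point, steps of length [eps / 2] in a fixed
    coordinate direction leave the bounded set [Omega] after at most [N] steps,
    [N] independent of the starting point, and the step that leaves crosses the
    boundary, where [u <= g <= M].  Hence [A - M <= 2 ^+ N * (A - u x)]
    everywhere.  Taking for [A] the supremum [S] of [u], and letting [u x]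
    approach [S], gives [S <= M] ([subsolution_le]).

    The envelope.  A compactness argument bounds [g] on the boundary,
    [m <= g <= M].  The constant [m] is a subsolution, so the upper envelope [U]
    lies between [m] and [M].  The midrange is monotone in [u], hence [U] is
    again a subsolution.  Finally the operator [perron_lift], which puts the
    midrange inside and [g] on the boundary, sends a subsolution to a
    subsolution that dominates it; applied to [U], maximality of [U] gives
    [perron_lift U <= U], which says that [U] is a supersolution.

    The lower envelope follows by the symmetry [u |-> - u], [g |-> - g]. *)

(** * Topology of the boundary *)

Lemma boundary_closure (T : topologicalType) (A : set T) :
  boundary A `<=` closure A.
Proof. by move=> x []. Qed.

Lemma open_boundaryNin (T : topologicalType) (A : set T) x :
  open A -> boundary A x -> ~ A x.
Proof. by move=> oA [_]; rewrite ((interior_id A).1 oA). Qed.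

Lemma open_closureP (T : topologicalType) (A : set T) x :
  open A -> closure A x -> A x \/ boundary A x.
Proof.
move=> oA clx; have [Ax|nAx] := pselect (A x); first by left.
by right; split => //; rewrite ((interior_id A).1 oA).
Qed.

Lemma closed_boundary (T : topologicalType) (A : set T) : closed (boundary A).
Proof.
rewrite /boundary setDE; apply: closedI; first exact: closed_closure.
by apply: open_closedC; exact: open_interior.
Qed.

Lemma bounded_boundary (R : realType) (n : nat) (A : set 'rV[R]_n) :
  bounded_set A -> bounded_set (boundary A).
Proof.
move=> [K [Kreal AK]]; exists K; split => // L KL x /boundary_closure.
have clL : closed (closed_ball_ (@Num.norm R _) (0 : 'rV[R]_n) L).
  exact: closed_closed_ball_.
have : A `<=` closed_ball_ (@Num.norm R _) (0 : 'rV[R]_n) L.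
  by move=> y /(AK _ KL); rewrite /closed_ball_ /= sub0r normrN.
move=> /closureS /[apply]; rewrite -((closure_id _).1 clL).
by rewrite /closed_ball_ /= sub0r normrN.
Qed.

(** If [A] missed the boundary of [B], its traces on the interior and on the
    closure of [B] would coincide, and so be a clopen part of [A]. *)
Lemma connected_meets_boundary (T : topologicalType) (A B : set T) x y :
  connected A -> A x -> A y -> B x -> ~ B y -> exists2 z, A z & boundary B z.
Proof.
move=> Aconn Ax Ay Bx nBy; apply: contrapT => noz.
have cl_int z : A z -> closure B z -> (B°)%classic z.
  by move=> Az clz; apply: contrapT => nz; apply: noz; exists z.
have eqA : A `&` closure B = A.
  apply: Aconn; first by exists x; split => //; exact: subset_closure.
  - exists (B°)%classic; first exact: open_interior.
    rewrite eqEsubset; split => z [Az Bz]; split => //; first exact: cl_int.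
    by apply: subset_closure; exact: interior_subset.
  - by exists (closure B) => //; exact: closed_closure.
have [_ cly] : (A `&` closure B) y by rewrite eqA.
by apply: nBy; apply: interior_subset; exact: cl_int.
Qed.

(** A boundary point need not be the first exit point: any crossing between
    [x] and the outside point is close enough to [x] for the walk below. *)
Lemma segment_meets_boundary (R : realType) (n : nat) (A : set 'rV[R]_n)
    (x e : 'rV[R]_n) (t : R) :
  0 <= t -> A x -> ~ A (x + t *: e) ->
  exists2 s, 0 <= s <= t & boundary A (x + s *: e).
Proof.
move=> t0 Ax nAy.
have cf : continuous (fun s : R => x + s *: e).
  by move=> s; apply: cvgD; [exact: cvg_cst|apply: cvgZr_tmp; exact: cvg_id].
have sconn := connected_continuous_connected (@segment_connected R 0 t)
  (continuous_subspaceT cf).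
have [||z [s /= + <-] bz] := connected_meets_boundary sconn _ _ Ax nAy.
- by exists 0; rewrite /= ?scale0r ?addr0// in_itv/= lexx.
- by exists t; rewrite //= in_itv/= lexx t0.
- by rewrite in_itv/= => st; exists s.
Qed.

Lemma compact_continuous_bounds (R : realType) (T : topologicalType)
    (A : set T) (f : T -> R) : compact A -> {within A, continuous f} ->
  exists B, forall x, A x -> `|f x| <= B.
Proof.
move=> cA /continuous_compact /(_ cA) /compact_bounded [B [_ AB]].
exists (B + 1) => x Ax; apply: AB; first by rewrite ltrDl.
by exists x.
Qed.

(** * Euclidean balls *)

Lemma enorm0 (R : realType) (n : nat) : enorm (0 : 'rV[R]_n) = 0.
Proof.
by rewrite /enorm big1 ?sqrtr0// => i _; rewrite mxE expr0n.
Qed.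

Lemma enormN (R : realType) (n : nat) (x : 'rV[R]_n) : enorm (- x) = enorm x.
Proof.
by rewrite /enorm; congr Num.sqrt; apply: eq_bigr => i _; rewrite mxE sqrrN.
Qed.

Lemma enorm_scale_delta (R : realType) (n : nat) (i : 'I_n) (t : R) :
  0 <= t -> enorm (t *: delta_mx 0 i) = t.
Proof.
move=> t0; rewrite /enorm (bigD1 i)//= big1 ?addr0.
  by rewrite !mxE !eqxx mulr1 sqrtr_sqr ger0_norm.
by move=> j ji; rewrite !mxE (negbTE ji) andbF mulr0 expr0n.
Qed.

Lemma eball_center (R : realType) (n : nat) (x : 'rV[R]_n) (e : R) :
  0 < e -> eball x e x.
Proof. by move=> e0; rewrite /eball /= subrr enorm0. Qed.

Lemma eball_add_delta (R : realType) (n : nat) (x : 'rV[R]_n) (i : 'I_n)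
    (e t : R) : 0 <= t < e -> eball x e (x + t *: delta_mx 0 i).
Proof.
move=> /andP[t0 te].
by rewrite /eball /= opprD addrA subrr sub0r enormN enorm_scale_delta.
Qed.

Lemma coord_le_norm (R : realType) (n : nat) (x : 'rV[R]_n) (i : 'I_n) :
  `|x ord0 i| <= `|x|.
Proof.
rewrite [leRHS]/Num.norm /= mx_normrE.
by apply: (@le_bigmax _ _ _ _ (fun ij => `|x ij.1 ij.2|) (ord0, i)).
Qed.

(** * Extended suprema and infima of real functions *)

Section SupInf.
Variables (R : realType) (n : nat).
Implicit Types (A : set 'rV[R]_n) (u v : 'rV[R]_n -> R) (c : R).
Local Open Scope ereal_scope.

Lemma le_sup_on A u y : A y -> (u y)%:E <= sup_on A u.
Proof. by move=> Ay; apply: ereal_sup_ubound; exists y. Qed.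

Lemma inf_on_le A u y : A y -> inf_on A u <= (u y)%:E.
Proof. by move=> Ay; apply: ereal_inf_lbound; exists y. Qed.

Lemma sup_on_le A u c : (forall y, A y -> (u y <= c)%R) -> sup_on A u <= c%:E.
Proof. by move=> h; apply: ge_ereal_sup => _ [y Ay <-]; rewrite lee_fin h. Qed.

Lemma le_inf_on A u c : (forall y, A y -> (c <= u y)%R) -> c%:E <= inf_on A u.
Proof.
by move=> h; apply: le_ereal_inf_tmp => _ [y Ay <-]; rewrite lee_fin h.
Qed.

Lemma sup_on_mono A u v :
  (forall y, A y -> (u y <= v y)%R) -> sup_on A u <= sup_on A v.
Proof.
move=> uv; apply: ge_ereal_sup => _ [y Ay <-].
by rewrite (le_trans _ (le_sup_on v Ay))// lee_fin uv.
Qed.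

Lemma inf_on_mono A u v :
  (forall y, A y -> (u y <= v y)%R) -> inf_on A u <= inf_on A v.
Proof.
move=> uv; apply: le_ereal_inf_tmp => _ [y Ay <-].
by rewrite (le_trans (inf_on_le u Ay))// lee_fin uv.
Qed.

Lemma sup_on_lty A u : A !=set0 -> sup_on A u < +oo ->
  exists c, sup_on A u = c%:E.
Proof.
move=> [y Ay]; have := le_sup_on u Ay.
by case: (sup_on A u) => [c|//|//] _ _; exists c.
Qed.

Lemma sup_onN A u : sup_on A (fun y => - u y)%R = - inf_on A u.
Proof.
rewrite /sup_on /inf_on -ereal_supN; congr ereal_sup.
by rewrite image_comp.
Qed.

Lemma inf_onN A u : inf_on A (fun y => - u y)%R = - sup_on A u.
Proof.
rewrite /sup_on /inf_on -ereal_infN; congr ereal_inf.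
by rewrite image_comp.
Qed.

End SupInf.

(** * The midrange operator *)

Section Midrange.
Variables (R : realType) (n : nat) (Omega : set 'rV[R]_n) (eps : R).
Hypothesis eps_gt0 : 0 < eps.
Implicit Types (u v : 'rV[R]_n -> R) (c : R).
Local Open Scope ereal_scope.
Let half_gt0 : (0 < 2^-1 :> R)%R. Proof. by rewrite invr_gt0. Qed.
Let ball_closure x := eball x eps `&` closure Omega.

Lemma midrange_mono u v x :
  (forall y, closure Omega y -> (u y <= v y)%R) ->
  midrange Omega eps u x <= midrange Omega eps v x.
Proof.
move=> uv; apply: leeD; rewrite lee_pmul2l// ?lte_fin//.
- by apply: sup_on_mono => y [_ /uv].
- by apply: inf_on_mono => y [_ /uv].
Qed.

(** The infimum is bounded by the value at a freely chosen point [y] of the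
    ball; this asymmetric estimate is what propagates information from [x]
    to [y]. *)
Lemma midrange_le u c x y :
  (forall z, closure Omega z -> (u z <= c)%R) ->
  ball_closure x y ->
  midrange Omega eps u x <= (2^-1 * c + 2^-1 * u y)%:E.
Proof.
move=> uc xy; rewrite EFinD !EFinM.
apply: leeD; rewrite lee_pmul2l// ?lte_fin//.
- by apply: sup_on_le => z [_ /uc].
- exact: inf_on_le.
Qed.

Lemma ball_closure_center x : Omega x -> ball_closure x x.
Proof. by move=> Ox; split; [exact: eball_center|exact: subset_closure]. Qed.

Lemma midrange_le_bound u c x : Omega x ->
  (forall z, closure Omega z -> (u z <= c)%R) -> midrange Omega eps u x <= c%:E.
Proof.
move=> Ox uc; apply: (le_trans (midrange_le uc (ball_closure_center Ox))).
by rewrite lee_fin; have := uc x (subset_closure Ox); lra.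
Qed.

Lemma midrange_ge_bound u c x : Omega x ->
  (forall z, closure Omega z -> (c <= u z)%R) -> c%:E <= midrange Omega eps u x.
Proof.
move=> Ox cu.
have -> : c%:E = (2^-1)%:E * c%:E + (2^-1)%:E * c%:E.
  by rewrite -!EFinM -EFinD; congr _%:E; lra.
apply: leeD; rewrite lee_pmul2l// ?lte_fin//.
- apply: (le_trans _ (le_sup_on u (ball_closure_center Ox))); rewrite lee_fin.
  exact/cu/subset_closure.
- by apply: le_inf_on => z [_ /cu].
Qed.

(** The bound on [u] excludes the sum [+oo - oo], on which negation does not
    distribute. *)
Lemma midrangeN u x : Omega x -> sup_on (closure Omega) u < +oo ->
  midrange Omega eps (fun y => - u y)%R x = - midrange Omega eps u x.
Proof.
move=> Ox su; rewrite /midrange sup_onN inf_onN !muleN.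
have supfin : sup_on (ball_closure x) u \is a fin_num.
  have ball_lty : sup_on (ball_closure x) u < +oo.
    by apply: le_lt_trans su; apply: ereal_sup_le => _ [y [_ cly] <-]; exists y.
  have ball_ne : ball_closure x !=set0.
    by exists x; exact: ball_closure_center.
  by have [c ->] := sup_on_lty ball_ne ball_lty.
by rewrite [in RHS]addeC fin_num_oppeD// fin_numM.
Qed.

End Midrange.

(** * The boundary bound for subsolutions *)

Section MaximumPrinciple.
Variables (R : realType) (n : nat) (Omega : set 'rV[R]_n) (eps : R).
Variables (g : 'rV[R]_n -> R) (M : R) (i : 'I_n) (K : R).
Hypotheses (Omega_open : open Omega) (eps_gt0 : 0 < eps).
Hypothesis Omega_bounded : forall x, Omega x -> `|x ord0 i| <= K.
Hypothesis g_le : forall x, boundary Omega x -> g x <= M.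

Lemma subsolution_gap_ball u A x y : subsolution Omega g eps u ->
  (forall z, closure Omega z -> u z <= A) ->
  Omega x -> eball x eps y -> closure Omega y ->
  A - u y <= 2 * (A - u x).
Proof.
move=> [_ umid _] uA Ox xy cly.
have := le_trans (umid x Ox) (midrange_le uA (conj xy cly)).
by rewrite lee_fin; lra.
Qed.

(** [k] bounds the number of steps of length [eps / 2] in direction [i] that
    stay in [Omega].  A step to a point of [Omega] uses up one of them; a step
    out of [Omega] is replaced by the shorter one to a boundary point on its
    segment. *)
Lemma subsolution_gap_boundary u A k x : subsolution Omega g eps u ->
  (forall z, closure Omega z -> u z <= A) -> M <= A ->
  Omega x -> K - x ord0 i < k%:R * (eps / 2) ->
  A - M <= 2 ^+ k * (A - u x).
Proof.
move=> subu uA MA; elim: k x => [|k IHk] x Ox.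
  by have := Omega_bounded Ox; rewrite ler_norml mul0r => /andP[_]; lra.
rewrite -natr1 mulrDl mul1r => xk.
have t0 : 0 <= eps / 2 by rewrite divr_ge0// ltW.
have teps : eps / 2 < eps by have := eps_gt0; lra.
have pow1 : 1 <= 2 ^+ k :> R by rewrite exprn_ege1// ler1n.
set y := x + (eps / 2) *: delta_mx 0 i.
have [Oy|nOy] := pselect (Omega y).
  have yk : K - y ord0 i < k%:R * (eps / 2).
    by move: xk; rewrite /y !mxE !eqxx mulr1; lra.
  apply: (le_trans (IHk _ Oy yk)); rewrite exprSr -mulrA.
  apply: ler_wpM2l; first by rewrite (le_trans ler01).
  apply: (subsolution_gap_ball subu uA Ox); last exact: subset_closure.
  by apply: eball_add_delta; rewrite t0.
have [s /andP[s0 st] bs] := segment_meets_boundary t0 Ox nOy.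
have [_ _ ug] := subu.
have Aus : A - M <= A - u (x + s *: delta_mx 0 i).
  by rewrite lerD2l lerN2 (le_trans (ug _ bs))// g_le.
apply: (le_trans Aus).
have xs : eball x eps (x + s *: delta_mx 0 i).
  by apply: eball_add_delta; rewrite s0 (le_lt_trans st).
apply: (le_trans (subsolution_gap_ball subu uA Ox xs (boundary_closure bs))).
rewrite exprS -mulrA ler_pM2l//.
by rewrite ler_peMl// subr_ge0 uA//; exact: subset_closure.
Qed.

(** With [S] the supremum of [u] and [N] steps enough from everywhere, the gap
    estimate reads [u <= S - (S - M) / 2 ^+ N], which contradicts the choice of
    [S] if [M < S]. *)
Lemma subsolution_le u x : subsolution Omega g eps u ->
  closure Omega x -> u x <= M.
Proof.
move=> subu clx; have [su _ ug] := subu.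
have [|S supS] := sup_on_lty _ su; first by exists x.
have uS z : closure Omega z -> u z <= S.
  by move=> clz; rewrite -lee_fin -supS le_sup_on.
have [SM|MS] := leP S M; first exact: le_trans (uS _ clx) SM.
(* The i-th coordinate varies by at most 2 * K over Omega. *)
pose N := (Num.truncn (2 * K / (eps / 2))).+1.
have KN : 2 * K < N%:R * (eps / 2).
  by rewrite -ltr_pdivrMr ?divr_gt0// truncnS_gt.
have pow0 : 0 < 2 ^+ N :> R by rewrite exprn_gt0.
have gap z : closure Omega z -> S - M <= 2 ^+ N * (S - u z).
  move=> clz; have [Oz|bz] := open_closureP Omega_open clz.
    apply: (subsolution_gap_boundary subu uS (ltW MS) Oz).
    have := Omega_bounded Oz; rewrite ler_norml => /andP[+ _].
    by move: KN; lra.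
  have uM : u z <= M by rewrite (le_trans (ug _ bz))// g_le.
  apply: (@le_trans _ _ (S - u z)); first by rewrite lerD2l lerN2.
  by rewrite ler_peMl ?subr_ge0 ?uS// exprn_ege1// ler1n.
have : (sup_on (closure Omega) u <= (S - (S - M) / 2 ^+ N)%:E)%E.
  apply: sup_on_le => z /gap; rewrite -ler_pdivrMl// mulrC; lra.
rewrite supS lee_fin => Sle.
have : 0 < (S - M) / 2 ^+ N by rewrite divr_gt0// subr_gt0.
by move: Sle; lra.
Qed.

End MaximumPrinciple.

(** * The envelope of subsolutions is a solution *)

Section Envelope.
Variables (R : realType) (n : nat) (Omega : set 'rV[R]_n) (eps : R).
Variables (g : 'rV[R]_n -> R) (m M : R) (i : 'I_n) (K : R).
Hypotheses (Omega_open : open Omega) (eps_gt0 : 0 < eps).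
Hypothesis Omega_bounded : forall x, Omega x -> `|x ord0 i| <= K.
Hypothesis g_bounds : forall x, boundary Omega x -> m <= g x <= M.

Let g_le x : boundary Omega x -> g x <= M.
Proof. by move=> /g_bounds/andP[]. Qed.

Local Notation U := (fine \o upper_envelope Omega g eps).

Lemma subsolution_cst : subsolution Omega g eps (fun=> m).
Proof.
split=> [|x Ox|x /g_bounds/andP[]//].
- by apply: (@le_lt_trans _ _ m%:E); [exact: sup_on_le|rewrite ltry].
- exact: midrange_ge_bound.
Qed.

Lemma upper_envelope_fin x : closure Omega x ->
  upper_envelope Omega g eps x \is a fin_num.
Proof.
move=> clx; rewrite fin_numElt; apply/andP; split.
  apply: (@lt_le_trans _ _ m%:E); first by rewrite ltNyr.
  by apply: ereal_sup_ubound; exists (fun=> m) => //; exact: subsolution_cst.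
apply: (@le_lt_trans _ _ M%:E); last by rewrite ltry.
apply: ge_ereal_sup => _ [u subu <-]; rewrite lee_fin.
exact: (subsolution_le Omega_open eps_gt0 Omega_bounded g_le subu).
Qed.

Lemma subsolution_le_envelope u x : subsolution Omega g eps u ->
  closure Omega x -> u x <= U x.
Proof.
move=> subu clx; rewrite -lee_fin /= fineK ?upper_envelope_fin//.
by apply: ereal_sup_ubound; exists u.
Qed.

Lemma upper_envelope_le x c : closure Omega x ->
  (forall u, subsolution Omega g eps u -> ((u x)%:E <= c)%E) ->
  ((U x)%:E <= c)%E.
Proof.
move=> clx uc; rewrite /= fineK ?upper_envelope_fin//.
by apply: ge_ereal_sup => _ [u subu <-]; exact: uc.
Qed.

Lemma upper_envelope_le_bound x : closure Omega x -> U x <= M.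
Proof.
move=> clx; rewrite -lee_fin; apply: upper_envelope_le => // u subu.
rewrite lee_fin.
exact: (subsolution_le Omega_open eps_gt0 Omega_bounded g_le subu).
Qed.

(** Each subsolution lies below its own midrange, hence, by monotonicity, below
    that of the envelope. *)
Lemma subsolution_upper_envelope : subsolution Omega g eps U.
Proof.
split.
- apply: (@le_lt_trans _ _ M%:E); last by rewrite ltry.
  by apply: sup_on_le; exact: upper_envelope_le_bound.
- move=> x Ox; apply: upper_envelope_le; first exact: subset_closure.
  move=> u subu; have [_ /(_ x Ox) umid _] := subu; apply: (le_trans umid).
  by apply: midrange_mono => y; exact: subsolution_le_envelope.
- move=> x bx; rewrite -lee_fin; apply: upper_envelope_le.
    exact: boundary_closure.
  by move=> u [_ _ ug]; rewrite lee_fin ug.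
Qed.

(** The fixed-point operator of the problem.  Taking [fine] loses nothing on
    subsolutions, whose midrange is finite inside [Omega]
    ([perron_lift_in]). *)
Definition perron_lift u : 'rV[R]_n -> R :=
  fun x => if `[< Omega x >] then fine (midrange Omega eps u x) else g x.

Lemma perron_lift_in u x : subsolution Omega g eps u -> Omega x ->
  (perron_lift u x)%:E = midrange Omega eps u x.
Proof.
move=> subu Ox; have [_ /(_ x Ox) umid _] := subu.
rewrite /perron_lift asboolT// fineK// fin_numElt; apply/andP; split.
  by apply: lt_le_trans umid; rewrite ltNyr.
apply: (@le_lt_trans _ _ M%:E); last by rewrite ltry.
apply: midrange_le_bound => // z clz.
exact: (subsolution_le Omega_open eps_gt0 Omega_bounded g_le subu).
Qed.

Lemma perron_lift_boundary u x : boundary Omega x -> perron_lift u x = g x.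
Proof.
by move=> bx; rewrite /perron_lift asboolF//; exact: open_boundaryNin.
Qed.

Lemma perron_lift_ge u x : subsolution Omega g eps u -> closure Omega x ->
  u x <= perron_lift u x.
Proof.
move=> subu clx; have [_ umid ug] := subu.
have [Ox|bx] := open_closureP Omega_open clx.
  by rewrite -lee_fin perron_lift_in// umid.
by rewrite perron_lift_boundary// ug.
Qed.

(** [perron_lift u] dominates [u], so its midrange dominates that of [u], which
    is [perron_lift u] itself. *)
Lemma subsolution_perron_lift u : subsolution Omega g eps u ->
  subsolution Omega g eps (perron_lift u).
Proof.
move=> subu; split.
- apply: (@le_lt_trans _ _ M%:E); last by rewrite ltry.
  apply: sup_on_le => x clx; have [Ox|bx] := open_closureP Omega_open clx.
    rewrite -lee_fin perron_lift_in//; apply: midrange_le_bound => // z.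
    exact: (subsolution_le Omega_open eps_gt0 Omega_bounded g_le subu).
  by rewrite perron_lift_boundary// g_le.
- move=> x Ox; rewrite perron_lift_in//; apply: midrange_mono => z.
  exact: perron_lift_ge.
- by move=> x bx; rewrite perron_lift_boundary.
Qed.

(** The lift of the envelope is a subsolution, hence at most the envelope: this
    is the supersolution inequality, both inside and on the boundary. *)
Lemma esolution_upper_envelope :
  esolution Omega g eps (upper_envelope Omega g eps).
Proof.
have subU := subsolution_upper_envelope.
have updU x : closure Omega x -> perron_lift U x <= U x.
  by apply: subsolution_le_envelope; exact: subsolution_perron_lift.
split; first exact: upper_envelope_fin.
split; first exact: subU.
split.
- apply: (@lt_le_trans _ _ m%:E); first by rewrite ltNyr.
  apply: le_inf_on => x; exact/subsolution_le_envelope/subsolution_cst.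
- move=> x Ox; rewrite -perron_lift_in// lee_fin.
  exact/updU/subset_closure.
- move=> x bx; rewrite -(perron_lift_boundary U bx).
  exact/updU/boundary_closure.
Qed.

End Envelope.

(** * Reflection, exchanging subsolutions and supersolutions *)

Section Reflection.
Variables (R : realType) (n : nat) (Omega : set 'rV[R]_n) (eps : R).
Variables (g : 'rV[R]_n -> R).
Hypothesis eps_gt0 : 0 < eps.

Lemma subsolutionN u : subsolution Omega g eps u ->
  supersolution Omega (fun x => - g x) eps (fun x => - u x).
Proof.
move=> [su umid ug]; split.
- by rewrite inf_onN lteNr.
- by move=> x Ox; rewrite midrangeN// EFinN leeN2 umid.
- by move=> x bx; rewrite lerN2 ug.
Qed.

Lemma supersolutionN u : supersolution Omega g eps u ->
  subsolution Omega (fun x => - g x) eps (fun x => - u x).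
Proof.
move=> [su umid ug].
have sNu : (sup_on (closure Omega) (fun x => - u x)%R < +oo)%E.
  by rewrite sup_onN lteNl.
split=> //.
- move=> x Ox; rewrite EFinN leeNl -midrangeN//.
  by under [X in midrange _ _ X]eq_fun do rewrite opprK; exact: umid.
- by move=> x bx; rewrite lerN2 ug.
Qed.

End Reflection.

Lemma lower_envelopeE (R : realType) (n : nat) (Omega : set 'rV[R]_n) (eps : R)
    (g : 'rV[R]_n -> R) : 0 < eps ->
  lower_envelope Omega g eps =
  (fun x => - upper_envelope Omega (fun y => - g y)%R eps x)%E.
Proof.
move=> eps_gt0; apply/funext => x; rewrite /lower_envelope /upper_envelope.
rewrite -ereal_infN image_comp; congr ereal_inf.
rewrite eqEsubset; split=> _ [u subu <-].
  exists (fun y => - u y); first exact: supersolutionN.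
  by rewrite /= opprK.
exists (fun y => - u y) => //.
have := subsolutionN eps_gt0 subu.
by under [X in supersolution _ X]eq_fun do rewrite opprK.
Qed.

Lemma esolutionN (R : realType) (n : nat) (Omega : set 'rV[R]_n) (eps : R)
    (g : 'rV[R]_n -> R) v : 0 < eps ->
  esolution Omega (fun x => - g x) eps v ->
  esolution Omega g eps (fun x => - v x)%E.
Proof.
move=> eps_gt0 [vfin [subv superv]].
have gE : g = (fun x => - - g x) by apply/funext => x; rewrite opprK.
have vE : fine \o (fun x => - v x)%E = (fun x => - (fine \o v) x).
  by apply/funext => x; rewrite /= fineN.
split; first by move=> x clx; rewrite fin_numN vfin.
rewrite vE gE; split; first exact: supersolutionN.
exact: subsolutionN.
Qed.

(** * Both envelopes are solutions *)

Unset Implicit Arguments.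

Theorem theorem1p4 (R : realType) (n : nat) (Omega : set 'rV[R]_n)
    (g : 'rV[R]_n -> R) (eps : R)
    (n_gt0 : (0 < n)%N)
    (Omega_dom : bounded_domain Omega)
    (g_cont : {within boundary Omega, continuous g})
    (eps_gt0 : 0 < eps) :
  esolution Omega g eps (upper_envelope Omega g eps) /\
  esolution Omega g eps (lower_envelope Omega g eps).
Proof.
have [_ Oopen _ Obnd] := Omega_dom.
have bdry_compact : compact (boundary Omega).
  apply: bounded_closed_compact; last exact: closed_boundary.
  exact: bounded_boundary.
have [B gB] := compact_continuous_bounds bdry_compact g_cont.
have [K [_ /(_ (K + 1))OK]] := Obnd.
pose i := Ordinal n_gt0.
have Oi x : Omega x -> `|x ord0 i| <= K + 1.
  move=> Ox; apply: le_trans (OK _ _ Ox); last by rewrite ltrDl.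
  exact: coord_le_norm.
have gbnd x : boundary Omega x -> - B <= g x <= B.
  by move=> /gB; rewrite ler_norml.
split; first exact: (esolution_upper_envelope Oopen eps_gt0 Oi gbnd).
rewrite lower_envelopeE//; apply: esolutionN => //.
apply: (esolution_upper_envelope (m := - B) (M := B) Oopen eps_gt0 Oi) => x bx.
by rewrite lerN2 lerNl andbC gbnd.
Qed.
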